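(* Let $n\ge 2$ be a power of $2$ and let $\mathcal{T}$ be a standard single-elimination tournament with $n$ players. Then for every scoring system $\sigma$ of $\mathcal{T}$ we have $\dim(\mathcal{T},\sigma)=n/2$. Moreover, for every such $n$ there exists a set of $n/2$ brackets of $\mathcal{T}$ which is $\sigma$-resolving for every scoring system $\sigma$.
   Context: A single-elimination tournament is a finite directed graph $\mathcal{T}$ such that: (a) $\mathcal{T}$ has exactly one sink (vertex with no out-neighbours); (b) every non-sink vertex has exactly one out-neighbour; (c) $\mathcal{T}$ has no directed cycles; (d) $|N^-(v)|\ne 1$ for every vertex $v$, where $N^-(v)$ denotes the set of in-neighbours of $v$. The players $P(\mathcal{T})$ are the sources (vertices with no in-neighbours) and the matches are $M(\mathcal{T})=V(\mathcal{T})\setminus P(\mathcal{T})$. $\mathcal{T}$ is standard if it is obtained from a complete binary tree by orienting all edges towards its center (root). A bracket is a function $B:V(\mathcal{T})\to P(\mathcal{T})$ with $B(a)=a$ for every player $a$ and $B(x)\in\{B(u):u\in N^-(x)\}$ for every match $x$. A scoring system is any function $\sigma:M(\mathcal{T})\to\mathbb{R}_{>0}$. For brackets $B,B'$ let $\mathrm{score}_\sigma(B,B')=\sum_{x\in M(\mathcal{T}):\,B(x)=B'(x)}\sigma(x)$. A set of brackets $\mathcal{B}$ is $\sigma$-resolving if for every pair of distinct brackets $B\ne B'$ there is $B_i\in\mathcal{B}$ with $\mathrm{score}_\sigma(B_i,B)\ne\mathrm{score}_\sigma(B_i,B')$. $\dim(\mathcal{T},\sigma)$ denotes the minimum size of a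 $\sigma$-resolving set. *)

(* Defs.v *)
From HB Require Import structures.
From mathcomp Require Import all_boot all_order all_algebra.
From mathcomp Require Import reals.
Set Implicit Arguments. Unset Strict Implicit. Unset Printing Implicit Defensive.
Import Order.TTheory GRing.Theory Num.Theory.
Local Open Scope ring_scope.

Section General.
Variables (V : finType) (e : rel V).

Definition in_nbrs (v : V) : {set V} := [set u | e u v].
Definition out_nbrs (v : V) : {set V} := [set w | e v w].

Definition is_set_tournament : Prop :=
  [/\ #|[set v | out_nbrs v == set0]| = 1%N,
      (forall v, out_nbrs v != set0 -> #|out_nbrs v| = 1%N),
      (forall (x : V) (p : seq V), path e x p -> last x p = x -> p = [::])
    & (forall v, #|in_nbrs v| <> 1%N)].

Definition players : {set V} := [set v | in_nbrs v == set0].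
Definition matches : {set V} := ~: players.

(* a bracket B : V -> P(T), represented as a function V -> V with values
   in the players *)
Definition bracket (B : {ffun V -> V}) : bool :=
  [&& [forall x, B x \in players],
      [forall a, (a \in players) ==> (B a == a)] &
      [forall x, (x \in matches) ==> [exists u, e u x && (B x == B u)]]].

Variable R : realType.

Definition scoring_system (sigma : V -> R) : Prop :=
  forall x, x \in matches -> 0 < sigma x.

Definition score (sigma : V -> R) (B B' : {ffun V -> V}) : R :=
  \sum_(x in matches | B x == B' x) sigma x.

Definition resolving (sigma : V -> R) (S : {set {ffun V -> V}}) : bool :=
  [forall B, forall B',
     [&& bracket B, bracket B' & B != B'] ==>
     [exists Bi in S, score sigma Bi B != score sigma Bi B']].

(* dim(T, sigma): minimum size of a sigma-resolving set of brackets.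
   (The set of all brackets is resolving, so its size is a valid default.) *)
Definition sdim (sigma : V -> R) : nat :=
  \big[minn/#|[set B | bracket B]|]_(S : {set {ffun V -> V}}
       | (S \subset [set B | bracket B]) && resolving sigma S) #|S|.

End General.

(* The standard single-elimination tournament with n = 2^k players:     *)
(* the complete binary tree of depth k in heap numbering, vertices      *)
(* 0 .. 2n-2, node i having children 2i+1 and 2i+2, every edge oriented *)
(* from child to parent (towards the root 0, the center of the tree).   *)
(* Players are the leaves n-1 .. 2n-2.                                  *)
Definition std_vertex (k : nat) := 'I_((2 ^ k.+1).-1).

Definition std_edge (k : nat) : rel (std_vertex k) :=
  fun u v => (val u == (val v).*2.+1) || (val u == (val v).*2.+2).

(* Main.v *)
(* Lower bound: with fewer than n/2 brackets, some player [a] of the left half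
   and some player [b] of the right half are the champion of none of them, and
   two brackets that differ only in whether [a] or [b] wins the final are not
   told apart.

   Upper bound: take one bracket per player [a] of the left half, with champion
   [a], such that the brackets of two first-round opponents [t], [t'] differ
   only on the path from [t] to the root.  The difference of their two scores
   against [B] is then the sum of sigma over the matches of that path won by [t]
   in [B], minus the same sum for [t'].  Only one of the two sums is nonzero and
   its matches form an initial segment of the path, so by positivity the
   difference tells how far [t] and [t'] advance in [B].  This determines [B] on
   the left half and in the final if a left player wins it.  The right half is
   then played according to a resolving family of n/4 brackets for that half,
   one for each first-round pair of the left half. *)
Require Import Defs.
From mathcomp Require Import all_boot all_order all_algebra.
From mathcomp Require Import reals.
From mathcomp Require Import zify lra.
Set Implicit Arguments. Unset Strict Implicit. Unset Printing Implicit Defensive.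
Import Order.TTheory GRing.Theory Num.Theory.

Local Open Scope nat_scope.

(** * Brackets on binary trees in heap numbering *)

Lemma eq_divn_half y v : (y %/ 2 == v) = (y == v.*2) || (y == v.*2.+1).
Proof. by apply/idP/idP; lia. Qed.

Lemma divn_exp2S t h : t %/ 2 ^ h.+1 = t %/ 2 ^ h %/ 2.
Proof. by rewrite expnSr divnMA. Qed.

Lemma divn_exp2S_eq t h v :
  (t %/ 2 ^ h.+1 == v) = (t %/ 2 ^ h == v.*2) || (t %/ 2 ^ h == v.*2.+1).
Proof. by rewrite divn_exp2S eq_divn_half. Qed.

(* Heap numbers are shifted to start at [1], so that the parent of [y] is
   [y %/ 2].  A bracket is a function [f] with [f j x] the winner at vertex [x],
   where [j] must be the height of [x]; the height is passed explicitly so that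
   the players below [x] are the [t] with [t %/ 2 ^ j = x]. *)
Definition agree_below (h v : nat) (f g : nat -> nat -> nat) : Prop :=
  forall j x, j <= h -> x %/ 2 ^ (h - j) = v -> f j x = g j x.

Fixpoint bracket_below (h v : nat) (f : nat -> nat -> nat) : Prop :=
  if h is h'.+1 then
    [/\ f h v = f h' v.*2 \/ f h v = f h' v.*2.+1,
        bracket_below h' v.*2 f & bracket_below h' v.*2.+1 f]
  else f 0 v = v.

Lemma bracket_belowS h v f :
  bracket_below h.+1 v f ->
  [/\ f h.+1 v = f h v.*2 \/ f h.+1 v = f h v.*2.+1,
      bracket_below h v.*2 f & bracket_below h v.*2.+1 f].
Proof. by []. Qed.

Lemma agree_belowS h v f g :
  agree_below h.+1 v f g <->
  [/\ f h.+1 v = g h.+1 v, agree_below h v.*2 f g & agree_below h v.*2.+1 f g].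
Proof.
split=> [fg | [fgv fgl fgr] j x].
  split; first by apply: fg; rewrite ?subnn ?divn1.
    move=> j x jh xv; apply: fg; first exact: leqW.
    by rewrite subSn //; apply/eqP; rewrite divn_exp2S_eq xv eqxx.
  move=> j x jh xv; apply: fg; first exact: leqW.
  by rewrite subSn //; apply/eqP; rewrite divn_exp2S_eq xv eqxx orbT.
rewrite leq_eqVlt => /predU1P[->|jh]; first by rewrite subnn divn1 => ->.
rewrite subSn // => /eqP; rewrite divn_exp2S_eq => /orP[]/eqP xv.
  exact: fgl.
exact: fgr.
Qed.

Lemma bracket_below_sub h v f j x :
  bracket_below h v f -> j <= h -> x %/ 2 ^ (h - j) = v -> bracket_below j x f.
Proof.
elim: h v => [|h IH] v.
  by case: j => // fv _; rewrite divn1 => ->.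
move=> fb; rewrite leq_eqVlt => /predU1P[->|jh].
  by rewrite subnn divn1 => ->.
case: fb => _ fl fr.
rewrite subSn // => /eqP; rewrite divn_exp2S_eq => /orP[]/eqP.
  exact: IH.
exact: IH.
Qed.

Lemma bracket_below_divn h v f : bracket_below h v f -> f h v %/ 2 ^ h = v.
Proof.
elim: h v => [|h IH] v /=; first by rewrite divn1.
case=> fv /IH fl /IH fr; apply/eqP; rewrite divn_exp2S_eq.
by case: fv => ->; rewrite ?fl ?fr eqxx ?orbT.
Qed.

(** The winner at a vertex is the winner at one of its children; following it down by induction
    reaches its own leaf, and it wins every match in between. *)
Lemma bracket_below_wins h v f j :
  bracket_below h v f -> j <= h -> f j (f h v %/ 2 ^ j) = f h v.
Proof.
elim: h v => [|h IH] v.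
  by case: j => //= fv _; rewrite fv divn1.
move=> fb; rewrite leq_eqVlt => /predU1P[->|jh].
  by rewrite bracket_below_divn.
by case: fb => -[] -> fl fr; apply: IH.
Qed.

(** * Brackets given by a ranking of players *)

(* The best-ranked player wins; when no ranked player takes part, the
   leftmost one does. *)
Fixpoint priority (s : seq nat) (h x : nat) : nat :=
  if s is t :: s' then if t %/ 2 ^ h == x then t else priority s' h x
  else x * 2 ^ h.

Lemma priority_child s h v :
  priority s h.+1 v = priority s h v.*2 \/
  priority s h.+1 v = priority s h v.*2.+1.
Proof.
elim: s => [|t s IH] /=.
  by left; rewrite expnS mulnA muln2.
rewrite divn_exp2S_eq.
by case: (_ =P v.*2) => [_|_]; [left|case: (_ =P v.*2.+1) => [_|_] //; right].
Qed.

Lemma bracket_below_priority s h v : bracket_below h v (priority s).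
Proof.
elim: h v => [|h IH] v /=.
  by elim: s => [|t s IH] /=; rewrite ?muln1 // divn1; case: eqP.
by split; first exact: priority_child.
Qed.

(** A player that is not below [v] is not below any vertex [x] of the subtree of [v], so its rank is
    never consulted there. *)
Lemma priority_skip h v t s :
  t %/ 2 ^ h <> v -> agree_below h v (priority (t :: s)) (priority s).
Proof.
move=> tv j x jh xv /=; case: eqP => // tx; case: tv.
by rewrite -xv -tx -divnMA -expnD subnKC.
Qed.

Lemma priority_all_skip h v s :
  all (fun t => t %/ 2 ^ h != v) s ->
  agree_below h v (priority s) (priority [::]).
Proof.
elim: s => [|t s IH] //= /andP[/eqP tv /IH{}IH] j x jh xv.
by have /= -> := priority_skip s tv jh xv; apply: IH.
Qed.

Lemma priority_cons_skip h v t s :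
  all (fun t => t %/ 2 ^ h != v) s ->
  agree_below h v (priority (t :: s)) (priority [:: t]).
Proof. by move=> sv j x jh xv /=; case: eqP => // _; exact: (priority_all_skip sv). Qed.

(* The favourite is player [a] of the left half; halving [a] makes first-round
   opponents of the left half share the same bracket of the right half. *)
Fixpoint ranking (v h a : nat) : seq nat :=
  if h is h'.+1 then (v * 2 ^ h + a) :: ranking v.*2.+1 h' a./2 else [::].

Lemma ranking_below v h a t :
  a < 2 ^ h.-1 -> t \in ranking v h a -> t %/ 2 ^ h = v.
Proof.
elim: h v a => [|h IH] v a //= ah; rewrite inE => /predU1P[->|tr].
  rewrite divnMDl ?expn_gt0 // divn_small ?addn0 //.
  by rewrite (leq_trans ah) // leq_exp2l.
apply/eqP; rewrite divn_exp2S_eq (IH _ _ _ tr) ?eqxx ?orbT //.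
by case: h ah tr {IH} => [|h] //=; rewrite expnS; lia.
Qed.

(** * Paths of first-round opponents and sums over initial segments *)

Local Open Scope ring_scope.

Lemma divn_double_succ s h : (s.*2.+1 %/ 2 ^ h.+1 = s.*2 %/ 2 ^ h.+1)%N.
Proof. by rewrite expnS !divnMA -[s.*2.+1]addn1; congr (_ %/ _)%N; lia. Qed.

Lemma divn_exp2_sibling s t i :
  t \in [:: s.*2; s.*2.+1] -> (0 < i)%N -> (t %/ 2 ^ i = s.*2 %/ 2 ^ i)%N.
Proof. by case: i => // i; rewrite !inE => /orP[]/eqP-> _; rewrite ?divn_double_succ. Qed.

Lemma wins_earlier h v f t i j :
  bracket_below h v f -> (t %/ 2 ^ h = v)%N -> (i <= j <= h)%N ->
  f j (t %/ 2 ^ j)%N = t -> f i (t %/ 2 ^ i)%N = t.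
Proof.
move=> fb tv /andP[ij jh] ft.
have xv : (t %/ 2 ^ j %/ 2 ^ (h - j) = v)%N by rewrite -divnMA -expnD subnKC.
by have := bracket_below_wins (bracket_below_sub fb jh xv) ij; rewrite ft.
Qed.

Lemma first_round_winner h v f s :
  (0 < h)%N -> bracket_below h v f -> (s.*2 %/ 2 ^ h = v)%N ->
  f 1 s = s.*2 \/ f 1 s = s.*2.+1.
Proof.
case: h => // h _ fb sv.
have [] := @bracket_below_sub _ _ _ 1 s fb isT _.
  by rewrite subn1 /= -sv expnS divnMA -muln2 mulnK.
by move=> /= fs fl fr; case: fs => ->; rewrite ?fl ?fr; [left|right].
Qed.

(** Each value [f j x] is a player [t] below [x], that is, [x] lies on the path of [t]. Knowing
    which matches each player wins therefore fixes the whole bracket. *)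
Lemma agree_below_of_wins h v f g :
  bracket_below h v f ->
  (forall t j, (t %/ 2 ^ h = v)%N -> (j <= h)%N ->
     f j (t %/ 2 ^ j)%N = t -> g j (t %/ 2 ^ j)%N = t) ->
  agree_below h v f g.
Proof.
move=> fb win j x jh xv.
have xE := bracket_below_divn (bracket_below_sub fb jh xv).
have := win (f j x) j _ jh; rewrite xE => -> //.
by rewrite -(subnKC jh) expnD divnMA xE.
Qed.

Lemma nested_sum_lt (R : numDomainType) (w : nat -> R) (p q : nat -> bool) m :
  (forall j, 0 < w j) ->
  (forall i, (1 <= i <= m.+1)%N -> p i) -> ~~ q m.+1 ->
  \sum_(1 <= j < m.+2) w j *+ q j < \sum_(1 <= j < m.+2) w j *+ p j.
Proof.
move=> w0 pT qF; rewrite !(big_nat_recr m.+1) //= (negbTE qF) pT ?leqnn //.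
apply: ler_ltD; last exact: w0.
rewrite big_nat [leRHS]big_nat; apply: ler_sum => j /andP[j1 jm].
have -> : p j by apply: pT; rewrite j1 ltnW.
by case: (q j) => //; apply: ltW; apply: w0.
Qed.

(** Both [p] and [q] hold on initial segments, and a sum of positive weights grows strictly with the
    length of the segment. The induction compares them at the last index. *)
Lemma nested_sum_inj (R : numDomainType) (w : nat -> R) (p q : nat -> bool) m :
  (forall j, 0 < w j) ->
  (forall i j, (1 <= i <= j)%N -> (j <= m)%N -> p j -> p i) ->
  (forall i j, (1 <= i <= j)%N -> (j <= m)%N -> q j -> q i) ->
  \sum_(1 <= j < m.+1) w j *+ p j = \sum_(1 <= j < m.+1) w j *+ q j ->
  forall j, (1 <= j <= m)%N -> p j = q j.
Proof.
move=> w0; elim: m => [|m IH] pn qn; first by move=> _ [].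
have [pm|pm] := boolP (p m.+1); have [qm|qm] := boolP (q m.+1) => eqS.
- move=> j jm.
  by rewrite (pn _ _ jm) // (qn _ _ jm).
- have := nested_sum_lt w0 (fun i im => pn i m.+1 im (leqnn _) pm) qm.
  by rewrite eqS ltxx.
- have := nested_sum_lt w0 (fun i im => qn i m.+1 im (leqnn _) qm) pm.
  by rewrite eqS ltxx.
move=> j /andP[j1]; rewrite leq_eqVlt => /predU1P[->|jm].
  by rewrite (negbTE pm) (negbTE qm).
apply: IH; rewrite ?j1 //.
- by move=> i i' ii' i'm; apply: pn => //; apply: leqW.
- by move=> i i' ii' i'm; apply: qn => //; apply: leqW.
by move: eqS; rewrite !(big_nat_recr m.+1) //= (negbTE pm) (negbTE qm) !addr0.
Qed.

(** * Scores on subtrees and along paths *)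

Section Score.
Variables (R : realType) (sigma : nat -> R).

(** Height 0 contributes nothing, since leaves are players and not matches. *)
Fixpoint score_below (h v : nat) (f g : nat -> nat -> nat) : R :=
  if h is h'.+1 then
    (sigma v *+ (f h v == g h v)
     + (score_below h' v.*2 f g + score_below h' v.*2.+1 f g))
  else 0.

Lemma eq_score_below h v f f' g g' :
  agree_below h v f f' -> agree_below h v g g' ->
  score_below h v f g = score_below h v f' g'.
Proof.
elim: h v => [|h IH] v //.
case/agree_belowS=> fv fl fr /agree_belowS[gv gl gr] /=.
by rewrite fv gv (IH _ fl gl) (IH _ fr gr).
Qed.

(** The path of [t] and the winner [u] are separate arguments because two first-round opponents
    share one path, always represented below by [s.*2]. *)
Definition path_score (h t u : nat) (g : nat -> nat -> nat) : R :=
  \sum_(1 <= j < h.+1) sigma (t %/ 2 ^ j) *+ (g j (t %/ 2 ^ j)%N == u).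

Lemma path_scoreS h t u g :
  path_score h.+1 t u g =
  path_score h t u g + sigma (t %/ 2 ^ h.+1) *+ (g h.+1 (t %/ 2 ^ h.+1)%N == u).
Proof. by rewrite /path_score big_nat_recr. Qed.

(** The two brackets differ only on the common path of the two opponents, so all other matches
    cancel. If that path does not reach [v], everything cancels. *)
Lemma score_below_siblings h v s g :
  score_below h v (priority [:: s.*2]) g - score_below h v (priority [:: s.*2.+1]) g
  = (path_score h s.*2 s.*2 g - path_score h s.*2 s.*2.+1 g)
    *+ (s.*2 %/ 2 ^ h == v)%N.
Proof.
elim: h v => [|h IH] v.
  by rewrite /path_score !big_geq //= subr0 mul0rn.
(* At most one of the two children has [s.*2] below it; the difference for the other child
   vanishes. *)
move: (IH v.*2) (IH v.*2.+1).
rewrite !path_scoreS /= divn_double_succ; have := divn_exp2S_eq s.*2 h v.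
case: (_ =P v) => [->|_]; rewrite ?(eq_sym _ (g _ _)).
  case: (_ =P v.*2) => [->|_] /=.
    rewrite (_ : (v.*2 == v.*2.+1)%N = false) => [_|]; last by lia.
    by rewrite !mulr1n !mulr0n; lra.
  by case: (_ =P v.*2.+1) => // _ _; rewrite !mulr1n !mulr0n; lra.
by case: (_ =P v.*2) => // _; case: (_ =P v.*2.+1) => // _ _; rewrite !mulr0n; lra.
Qed.

Hypothesis sigma_gt0 : forall x, 0 < sigma x.

(** A win anywhere on the path would entail a win in the first round, by [wins_earlier]. *)
Lemma path_score_loser h v f s t :
  bracket_below h v f -> (s.*2 %/ 2 ^ h = v)%N ->
  t \in [:: s.*2; s.*2.+1] -> f 1 s <> t ->
  path_score h s.*2 t f = 0.
Proof.
move=> fb sv ts ft; rewrite /path_score big_nat big1 // => j /andP[j1 jh].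
have td := divn_exp2_sibling ts.
case: eqP => // fj; case: ft.
have s1 : (t %/ 2 ^ 1 = s)%N by rewrite td // -muln2 mulnK.
rewrite -{1}s1; apply: (wins_earlier fb _ (j := j)); rewrite ?j1 ?td //.
by apply: leq_trans j1 _.
Qed.

Lemma path_score_winner h f s :
  (0 < h)%N -> path_score h s.*2 (f 1 s) f > 0.
Proof.
case: h => // h _; rewrite /path_score big_ltn //.
have -> : (s.*2 %/ 2 ^ 1)%N = s by rewrite -muln2 mulnK.
rewrite eqxx mulr1n ltr_pwDl //; apply: sumr_ge0 => j _.
by rewrite mulrn_wge0 // ltW.
Qed.

Lemma path_score_inj h v f g s t :
  bracket_below h v f -> bracket_below h v g -> (s.*2 %/ 2 ^ h = v)%N ->
  t \in [:: s.*2; s.*2.+1] ->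
  path_score h s.*2 t f = path_score h s.*2 t g ->
  forall j, (1 <= j <= h)%N ->
  (f j (t %/ 2 ^ j)%N == t) = (g j (t %/ 2 ^ j)%N == t).
Proof.
move=> fb gb sv ts eqS.
pose wins b j := b j (t %/ 2 ^ j)%N == t.
have nested b : bracket_below h v b ->
  forall i j, (1 <= i <= j)%N -> (j <= h)%N -> wins b j -> wins b i.
  move=> bb i j /andP[i1 ij] jh /eqP bj; apply/eqP.
  apply: (wins_earlier bb _ (j := j)); rewrite ?ij //.
  by rewrite (divn_exp2_sibling ts) //; lia.
apply: (nested_sum_inj (w := fun j => sigma (s.*2 %/ 2 ^ j))
  (p := wins f) (q := wins g) _ (nested f fb) (nested g gb)) => //.
have winsE b : \sum_(1 <= j < h.+1) sigma (s.*2 %/ 2 ^ j) *+ wins b j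
               = path_score h s.*2 t b.
  rewrite /path_score !big_nat; apply: eq_bigr => j /andP[j1 _].
  by rewrite /wins (divn_exp2_sibling ts).
by rewrite !winsE.
Qed.

(** One of the two path scores is zero and the other is positive, so the sign of the difference
    tells who wins the first round and its absolute value how far that player advances. *)
Lemma sibling_scores_inj h v f g s :
  (0 < h)%N -> bracket_below h v f -> bracket_below h v g ->
  (s.*2 %/ 2 ^ h = v)%N ->
  path_score h s.*2 s.*2 f - path_score h s.*2 s.*2.+1 f
    = path_score h s.*2 s.*2 g - path_score h s.*2 s.*2.+1 g ->
  forall t j, t \in [:: s.*2; s.*2.+1] -> (1 <= j <= h)%N ->
  (f j (t %/ 2 ^ j)%N == t) = (g j (t %/ 2 ^ j)%N == t).
Proof.
move=> h0 fb gb sv eqD.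
have l2 : s.*2 \in [:: s.*2; s.*2.+1] by rewrite inE eqxx.
have r2 : s.*2.+1 \in [:: s.*2; s.*2.+1] by rewrite !inE eqxx orbT.
have fP := @path_score_winner h f s h0; have gP := @path_score_winner h g s h0.
suff [eql eqr] : path_score h s.*2 s.*2 f = path_score h s.*2 s.*2 g /\
    path_score h s.*2 s.*2.+1 f = path_score h s.*2 s.*2.+1 g.
  move=> t j ts; apply: (path_score_inj fb gb sv ts _).
  by move: ts; rewrite !inE => /orP[]/eqP->.
have f2 : f 1 s = s.*2 -> path_score h s.*2 s.*2.+1 f = 0.
  by move=> f1; apply: (path_score_loser fb sv r2); rewrite f1; lia.
have f3 : f 1 s = s.*2.+1 -> path_score h s.*2 s.*2 f = 0.
  by move=> f1; apply: (path_score_loser fb sv l2); rewrite f1; lia.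
have g2 : g 1 s = s.*2 -> path_score h s.*2 s.*2.+1 g = 0.
  by move=> g1; apply: (path_score_loser gb sv r2); rewrite g1; lia.
have g3 : g 1 s = s.*2.+1 -> path_score h s.*2 s.*2 g = 0.
  by move=> g1; apply: (path_score_loser gb sv l2); rewrite g1; lia.
(* When the first-round winners in [f] and [g] differ, the two differences have opposite signs,
   which contradicts [eqD]. *)
case: (first_round_winner h0 fb sv) => f1; case: (first_round_winner h0 gb sv) => g1;
move: (f1) (g1) fP gP eqD => -> -> fP gP.
- by rewrite (f2 f1) (g2 g1) !subr0.
- by rewrite (f2 f1) (g3 g1); lra.
- by rewrite (f3 f1) (g2 g1); lra.
by rewrite (f3 f1) (g3 g1) => eqD; split => //; lra.
Qed.

(** * The rankings resolve all brackets *)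

(** The favourite [t] lies in the left half and all other ranked players in the right half, so the
    two halves do not interact. The score is written as a correction of that of [[:: t]] to make
    [score_below_siblings] applicable. *)
Lemma score_ranking h v a b (t := (v * 2 ^ h.+2 + a)%N) : (a < 2 ^ h.+1)%N ->
  score_below h.+2 v (priority (ranking v h.+2 a)) b =
  score_below h.+2 v (priority [:: t]) b
  - score_below h.+1 v.*2.+1 (priority [::]) b
  + score_below h.+1 v.*2.+1 (priority (ranking v.*2.+1 h.+1 a./2)) b.
Proof.
move=> ah; have a2 : (a./2 < 2 ^ h)%N by move: ah; rewrite expnS; lia.
have tl : (t %/ 2 ^ h.+1 = v.*2)%N.
  rewrite /t expnS mulnA muln2 divnMDl ?expn_gt0 //.
  by rewrite divn_small ?addn0.
have tv : (t %/ 2 ^ h.+2 = v)%N by rewrite divn_exp2S tl -muln2 mulnK.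
have tr : (t %/ 2 ^ h.+1 <> v.*2.+1)%N by rewrite tl; lia.
have rl : all (fun u => u %/ 2 ^ h.+1 != v.*2)%N (ranking v.*2.+1 h.+1 a./2).
  by apply/allP => u /ranking_below -> //; lia.
rewrite -[ranking v _ _]/(t :: ranking v.*2.+1 h.+1 a./2).
have scoreE r : score_below h.+2 v (priority (t :: r)) b =
  sigma v *+ (t == b h.+2 v)
  + (score_below h.+1 v.*2 (priority (t :: r)) b
     + score_below h.+1 v.*2.+1 (priority (t :: r)) b).
  by rewrite /= tv eqxx.
have refl u : agree_below h.+1 u b b by [].
rewrite !scoreE (eq_score_below (priority_cons_skip t rl) (refl _)).
rewrite !(eq_score_below (priority_skip _ tr) (refl _)).
lra.
Qed.

Lemma ranking_resolves h v f g :
  bracket_below h.+1 v f -> bracket_below h.+1 v g ->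
  (forall a, (a < 2 ^ h)%N ->
     score_below h.+1 v (priority (ranking v h.+1 a)) f =
     score_below h.+1 v (priority (ranking v h.+1 a)) g) ->
  agree_below h.+1 v f g.
Proof.
elim: h v => [|h IH] v fb gb eqS.
  (* With a single match, the only bracket predicts its left player, and [sigma v > 0] tells whether
     that is correct. *)
  have [fv fl fr] := bracket_belowS fb; have [gv gl gr] := bracket_belowS gb.
  apply/agree_belowS; split; last 2 first.
  - by move=> j x; rewrite leqn0 => /eqP->; rewrite divn1 => ->; rewrite fl gl.
  - by move=> j x; rewrite leqn0 => /eqP->; rewrite divn1 => ->; rewrite fr gr.
  have s0 := sigma_gt0 v.
  move: fl fr gl gr fv gv (eqS 0 isT) => /= -> -> -> ->.
  rewrite !addr0 muln2 addn0 (_ : (v.*2 %/ 2 ^ 1)%N = v) ?eqxx; last first.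
    by rewrite -muln2 mulnK.
  have neq : (v.*2 == v.*2.+1) = false by lia.
  by case=> -> [] -> //; rewrite eqxx neq mulr1n mulr0n => ?; exfalso; lra.
have wins t j : (t %/ 2 ^ h.+1 = v.*2)%N -> (1 <= j <= h.+2)%N ->
  (f j (t %/ 2 ^ j)%N == t) = (g j (t %/ 2 ^ j)%N == t).
  (* [s] is the first-round match of [t] and [p] its position among those of the left half; the
     favourites [p.*2] and [p.*2.+1] are its two players. *)
  move=> tl; set s := t./2; set p := (s %% 2 ^ h)%N.
  have ph : (p < 2 ^ h)%N by rewrite ltn_mod expn_gt0.
  have sE : s = (v * 2 ^ h.+1 + p)%N.
    have sq : (s %/ 2 ^ h)%N = v.*2 by rewrite /s -divn2 -divnMA -expnS.
    by rewrite [LHS](divn_eq _ (2 ^ h)) sq -/p expnS mulnA muln2.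
  have p0 : (p.*2 < 2 ^ h.+1)%N by rewrite expnS; lia.
  have p1 : (p.*2.+1 < 2 ^ h.+1)%N by rewrite expnS; lia.
  have s0 : (v * 2 ^ h.+2 + p.*2)%N = s.*2 by rewrite sE [in LHS]expnS; lia.
  have s1 : (v * 2 ^ h.+2 + p.*2.+1)%N = s.*2.+1 by rewrite addnS s0.
  have sv : (s.*2 %/ 2 ^ h.+2 = v)%N.
    rewrite -s0 divnMDl ?expn_gt0 // divn_small ?addn0 //.
    by rewrite (leq_trans p0) // leq_exp2l.
  apply: (sibling_scores_inj (h := h.+2) (v := v) (s := s)) => //; last first.
    by rewrite !inE /s; lia.
  (* Both favourites have the same half [p], so subtracting the two equations cancels the right half
     and leaves the difference of path scores. *)
  move: (eqS _ p0) (eqS _ p1); rewrite !score_ranking // s0 s1.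
  rewrite (_ : p.*2.+1./2 = p.*2./2); last by lia.
  move: (score_below_siblings h.+2 v s f) (score_below_siblings h.+2 v s g).
  by rewrite sv eqxx !mulr1n; lra.
have [fv fl fr] := bracket_belowS fb; have [gv gl gr] := bracket_belowS gb.
have topl u : (u %/ 2 ^ h.+1 = v.*2)%N -> (f h.+2 v == u) = (g h.+2 v == u).
  move=> ul; have := wins u h.+2 ul (leqnn _).
  by rewrite divn_exp2S ul -muln2 mulnK.
have agl : agree_below h.+1 v.*2 f g.
  apply: (agree_below_of_wins fl) => t [|j] tl jh; last first.
    by move=> /eqP ft; apply/eqP; rewrite -wins //=; apply: leqW.
  move=> _; rewrite divn1.
  by have /= -> := @bracket_below_sub _ _ _ 0 t gl isT; rewrite ?subn0.
(* One favourite per pair, [p.*2], suffices here. The left halves agree by [agl] and [topl] gives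
   equal contributions of the final, so the right-half scores are equal as well. *)
have agr : agree_below h.+1 v.*2.+1 f g.
  apply: IH fr gr _ => p ph.
  have p0 : (p.*2 < 2 ^ h.+1)%N by rewrite expnS; lia.
  have := eqS _ p0.
  set t := (v * 2 ^ h.+2 + p.*2)%N.
  have tl : (t %/ 2 ^ h.+1 = v.*2)%N.
    by rewrite /t expnS mulnA muln2 divnMDl ?expn_gt0 // divn_small ?addn0.
  have tv : (t %/ 2 ^ h.+2 = v)%N by rewrite divn_exp2S tl -muln2 mulnK.
  rewrite !score_ranking // -/t doubleK.
  have scoreE b : score_below h.+2 v (priority [:: t]) b =
    sigma v *+ (t == b h.+2 v)
    + (score_below h.+1 v.*2 (priority [:: t]) b
       + score_below h.+1 v.*2.+1 (priority [:: t]) b).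
    by rewrite /= tv eqxx.
  have tr : (t %/ 2 ^ h.+1 <> v.*2.+1)%N by rewrite tl; lia.
  have refl b u : agree_below h.+1 u b b by [].
  rewrite !scoreE !(eq_score_below (priority_skip _ tr) (refl _ _)).
  rewrite !(eq_sym t) topl // (eq_score_below (refl (priority [:: t]) _) agl).
  lra.
apply/agree_belowS; split=> //.
have fgl : f h.+1 v.*2 = g h.+1 v.*2 by apply: agl; rewrite ?subnn ?divn1.
have fgr : f h.+1 v.*2.+1 = g h.+1 v.*2.+1 by apply: agr; rewrite ?subnn ?divn1.
(* If a left player wins the final in [f] or in [g], then [topl] gives the same champion in the
   other; otherwise both champions are the right-half winner, on which [f] and [g] agree. *)
case: fv => [fE|fE].
  by apply/esym/eqP; rewrite -topl fE // bracket_below_divn.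
case: gv => [gE|gE]; last by rewrite fE gE.
by apply/eqP; rewrite topl gE // bracket_below_divn.
Qed.
End Score.

(** * Translation between the standard tournament and heap functions *)

Local Open Scope nat_scope.

Section Standard.
Variable k : nat.

Lemma std_vertex_gt0 : 0 < (2 ^ k.+1).-1.
Proof. by rewrite expnS; have := expn_gt0 2 k; lia. Qed.

(** Heap numbers start at 1 and ordinals at 0, hence the predecessor; numbers out of range are sent
    to the root. *)
Definition vtx (y : nat) : std_vertex k := insubd (Ordinal std_vertex_gt0) y.-1.
Definition height (y : nat) : nat := k - trunc_log 2 y.

(** The height argument is ignored, as a heap number already determines its height. *)
Definition code (B : {ffun std_vertex k -> std_vertex k}) : nat -> nat -> nat :=
  fun _ y => (B (vtx y)).+1.
Definition decode (f : nat -> nat -> nat) : {ffun std_vertex k -> std_vertex k} :=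
  [ffun x : std_vertex k => vtx (f (height (val x).+1) (val x).+1)].

Lemma vtxK y : 0 < y < 2 ^ k.+1 -> (val (vtx y)).+1 = y.
Proof. by move=> yk; rewrite val_insubd ifT; lia. Qed.

Lemma std_vertex_lt (x : std_vertex k) : (val x).+1 < 2 ^ k.+1.
Proof. by have := ltn_ord x; rewrite /=; lia. Qed.

Lemma val_vtxK (x : std_vertex k) : vtx (val x).+1 = x.
Proof. by apply: val_inj; apply: succn_inj; rewrite vtxK // std_vertex_lt. Qed.

Lemma height_range j y : j <= k -> y %/ 2 ^ (k - j) = 1 ->
  [/\ 0 < y, 2 ^ (k - j) <= y, y < 2 ^ (k - j).+1 & y < 2 ^ k.+1].
Proof.
move=> jk y1.
have ge : 2 ^ (k - j) <= y by rewrite leqNgt; apply/negP => /divn_small; rewrite y1.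
have lt : y < 2 ^ (k - j).+1.
  by rewrite expnS -ltn_divLR ?expn_gt0 // y1.
split=> //; first by apply: leq_trans ge; rewrite expn_gt0.
by apply: leq_trans lt _; rewrite leq_exp2l // ltnS leq_subr.
Qed.

Lemma heightE j y : j <= k -> y %/ 2 ^ (k - j) = 1 -> height y = j.
Proof.
move=> jk /(height_range jk)[_ ge lt _].
by rewrite /height (@trunc_log_eq 2 (k - j)) ?ge ?subKn.
Qed.

Lemma height_le y : height y <= k.
Proof. exact: leq_subr. Qed.

Lemma height_divn y : 0 < y < 2 ^ k.+1 -> y %/ 2 ^ (k - height y) = 1.
Proof.
case/andP=> y0 yk.
have [ge lt] := andP (trunc_log_bounds (isT : 1 < 2) y0).
have tk : trunc_log 2 y <= k by rewrite -ltnS -(ltn_exp2l _ _ (isT : 1 < 2)); lia.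
rewrite /height subKn //; apply/eqP; rewrite eqn_leq -ltnS.
by rewrite ltn_divLR ?expn_gt0 // divn_gt0 ?expn_gt0 // ge -expnS lt.
Qed.

Lemma std_edgeE (u v : std_vertex k) :
  std_edge u v = ((val u).+1 == (val v).+1.*2) || ((val u).+1 == (val v).+1.*2.+1).
Proof. by rewrite /std_edge; lia. Qed.

Lemma std_playersE (x : std_vertex k) :
  (x \in players (@std_edge k)) = (2 ^ k <= (val x).+1).
Proof.
rewrite inE; apply/eqP/idP => [x0|xk].
  rewrite leqNgt; apply/negP => xk.
  have: vtx (val x).+1.*2 \in in_nbrs (@std_edge k) x.
    by rewrite inE std_edgeE vtxK ?eqxx //; have := expnS 2 k; lia.
  by rewrite x0 inE.
apply/setP => u; rewrite !inE std_edgeE; have := std_vertex_lt u; have := expnS 2 k; lia.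
Qed.

Lemma std_matchesE (x : std_vertex k) :
  (x \in matches (@std_edge k)) = ((val x).+1 < 2 ^ k).
Proof. by rewrite inE std_playersE ltnNge. Qed.

Lemma bracket_code B : bracket (@std_edge k) B -> bracket_below k 1 (code B).
Proof.
case/and3P=> _ /forallP Bp /forallP Bm.
suff codeB j y : j <= k -> y %/ 2 ^ (k - j) = 1 -> bracket_below j y (code B).
  by apply: codeB; rewrite ?subnn.
elim: j y => [|j IH] y jk yj.
  have [y0 ge _ lt] := height_range jk yj.
  have yk : 0 < y < 2 ^ k.+1 by rewrite y0.
  rewrite /= /code; have := Bp (vtx y); rewrite std_playersE vtxK //.
  by rewrite -{1}(subn0 k) ge => /eqP->; rewrite vtxK.
have [y0 _ lt yk] := height_range jk yj.
have child c : c %/ 2 = y -> c %/ 2 ^ (k - j) = 1.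
  by move=> cy; rewrite -(subnSK jk) expnS divnMA cy.
have cl : y.*2 %/ 2 = y by rewrite divn2 doubleK.
have cr : y.*2.+1 %/ 2 = y by rewrite divn2 /= uphalf_double.
split; [|exact: IH (ltnW jk) (child _ cl)|exact: IH (ltnW jk) (child _ cr)].
have yk' : y < 2 ^ k.
  by apply: leq_trans lt _; rewrite leq_exp2l // subnSK ?leq_subr.
have := Bm (vtx y); rewrite std_matchesE vtxK ?y0 // yk' => /existsP[u /andP[]].
rewrite std_edgeE vtxK ?y0 // /code => eu /eqP->.
by rewrite -{1 2}(val_vtxK u); case/orP: eu => /eqP->; [left|right].
Qed.

Lemma bracket_below_range f j y :
  bracket_below k 1 f -> j <= k -> y %/ 2 ^ (k - j) = 1 ->
  2 ^ k <= f j y < 2 ^ k.+1.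
Proof.
move=> fb jk yj; have fE := bracket_below_divn (bracket_below_sub fb jk yj).
have: f j y %/ 2 ^ k = 1 by rewrite -(subnKC jk) expnD divnMA fE.
by have := @height_range 0 (f j y) (leq0n _); rewrite subn0 => H /H[_ -> _ ->].
Qed.

(** Agreement is claimed only where [j] is the true height of [y], because [decode] recomputes the
    height from the vertex. *)
Lemma decodeK f : bracket_below k 1 f -> agree_below k 1 (code (decode f)) f.
Proof.
move=> fb j y jk yj; have [y0 _ _ yk] := height_range jk yj.
rewrite /code ffunE (vtxK (y := y)) ?y0 // (heightE jk yj) vtxK //.
by have /andP[ge ->] := bracket_below_range fb jk yj; rewrite (leq_trans _ ge) ?expn_gt0.
Qed.

Lemma bracket_decode f : bracket_below k 1 f -> bracket (@std_edge k) (decode f).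
Proof.
move=> fb.
have codeE j y : j <= k -> y %/ 2 ^ (k - j) = 1 -> (val (decode f (vtx y))).+1 = f j y.
  exact: decodeK fb j y.
have xE (x : std_vertex k) : (val (decode f x)).+1 = f (height (val x).+1) (val x).+1.
  rewrite -{1}(val_vtxK x); apply: codeE; first exact: height_le.
  by rewrite height_divn // std_vertex_lt.
apply/and3P; split; apply/forallP => x; rewrite ?std_playersE ?std_matchesE ?xE.
- have hx : (val x).+1 %/ 2 ^ (k - height (val x).+1) = 1.
    by rewrite height_divn // std_vertex_lt.
  by have /andP[] := bracket_below_range fb (height_le _) hx.
- apply/implyP => xk; apply/eqP/val_inj/succn_inj; rewrite xE.
  have x1 : (val x).+1 %/ 2 ^ (k - 0) = 1.
    apply/eqP; rewrite subn0 eqn_leq -ltnS ltn_divLR ?expn_gt0 // -expnS.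
    by rewrite divn_gt0 ?expn_gt0 // xk std_vertex_lt.
  by rewrite (heightE _ x1) //; apply: bracket_below_sub fb _ x1.
apply/implyP => xk; set y := (val x).+1 in xk *.
have y1 : y %/ 2 ^ (k - height y) = 1 by rewrite height_divn // std_vertex_lt.
have hk := height_le y.
have [y0 ge _ _] := height_range hk y1.
case hE: (height y) => [|j].
  by move: ge; rewrite hE subn0 leqNgt xk.
have jk : j <= k by rewrite ltnW // -hE.
have child c : c %/ 2 = y -> c %/ 2 ^ (k - j) = 1.
  by move=> cy; rewrite -subnSK -?hE // expnS divnMA cy.
have [fE _ _] : [/\ f j.+1 y = f j y.*2 \/ f j.+1 y = f j y.*2.+1,
      bracket_below j y.*2 f & bracket_below j y.*2.+1 f].
  by apply/bracket_belowS/(bracket_below_sub fb); rewrite -hE.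
have win c : (c == y.*2) || (c == y.*2.+1) -> f j.+1 y = f j c ->
  [exists u, std_edge u x && (decode f x == decode f u)].
  move=> cy fc; have c1 : c %/ 2 ^ (k - j) = 1.
    by apply: child; apply/eqP; rewrite eq_divn_half.
  have [c0 _ _ ck] := height_range jk c1.
  apply/existsP; exists (vtx c); rewrite std_edgeE vtxK ?c0 // cy /=.
  by apply/eqP/val_inj/succn_inj; rewrite xE -/y hE fc (codeE j c).
by case: fE => fE; apply: win fE; rewrite eqxx ?orbT.
Qed.

Lemma code_inj B B' : agree_below k 1 (code B) (code B') -> B = B'.
Proof.
move=> BB'; apply/ffunP => x; apply/val_inj/succn_inj.
have := BB' (height (val x).+1) (val x).+1 (height_le _).
by rewrite /code val_vtxK; apply; rewrite height_divn // std_vertex_lt.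
Qed.

Local Open Scope ring_scope.

(** * Comparison of the two notions of score *)

Section StandardScore.
Variables (R : realType) (sigma : std_vertex k -> R).

(** A scoring system is positive on matches only; the default 1 makes the weight positive
    everywhere, as [sigma_gt0] demands. *)
Definition weight (y : nat) : R :=
  if (0 < y < 2 ^ k)%N then sigma (vtx y) else 1.

Lemma weight_gt0 : scoring_system (@std_edge k) sigma -> forall y, 0 < weight y.
Proof.
move=> s0 y; rewrite /weight; case: ifP => // /andP[y0 yk].
by apply: s0; rewrite std_matchesE vtxK // y0 expnS; lia.
Qed.

(** The descendants of [v] at depth [d] are the heap numbers from [v * 2 ^ d] up to, but excluding,
    [v.+1 * 2 ^ d]; the intervals of the two children are adjacent and join into the next level of
    [v]. *)
Lemma score_below_levels (w : nat -> R) h v (f g : nat -> nat) :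
  score_below w h v (fun=> f) (fun=> g) =
  \sum_(d < h) \sum_(v * 2 ^ d <= y < v.+1 * 2 ^ d) w y *+ (f y == g y).
Proof.
elim: h v => [|h IH] v; first by rewrite big_ord0.
rewrite big_ord_recl /= !muln1 big_nat1; congr (_ + _).
rewrite !IH -big_split; apply: eq_bigr => d _ /=.
rewrite /bump /= add1n expnS !mulnA !muln2 doubleS -big_cat_nat //=.
  by rewrite leq_mul2r leqnSn orbT.
by rewrite leq_mul2r leqnSn orbT.
Qed.

Lemma big_nat_levels (F : nat -> R) h :
  \sum_(d < h) \sum_(1 * 2 ^ d <= y < 2 * 2 ^ d) F y = \sum_(1 <= y < 2 ^ h) F y.
Proof.
elim: h => [|h IH]; first by rewrite big_ord0 big_geq.
rewrite big_ord_recr /= IH mul1n -expnS -big_cat_nat //=.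
  by rewrite expn_gt0.
by rewrite leq_exp2l.
Qed.

Lemma score_code B B' :
  score (@std_edge k) sigma B B' = score_below weight k 1 (code B) (code B').
Proof.
rewrite score_below_levels big_nat_levels /score big_mkcond /=.
(* Extending the summand by zero to the players turns the sum over matches into one over all
   vertices, which can be reindexed by heap numbers. *)
pose G y := if (y < 2 ^ k)%N
  then weight y *+ ((val (B (vtx y))).+1 == (val (B' (vtx y))).+1) else 0.
rewrite (eq_bigr (fun x : std_vertex k => G (val x).+1)); last first.
  move=> x _; rewrite /G std_matchesE /weight; case: ltnP => // xk.
  by rewrite !val_vtxK eqSS /= val_eqE; case: eqP; rewrite ?mulr1n ?mulr0n.
transitivity (\sum_(1 <= y < 2 ^ k.+1) G y); first by rewrite big_add1 big_mkord.
rewrite (big_cat_nat _ (n := 2 ^ k)) ?expn_gt0 ?leq_exp2l //=.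
rewrite [X in _ + X]big_nat [X in _ + X]big1 ?addr0; last first.
  by move=> y /andP[yk _]; rewrite /G ltnNge yk.
by rewrite !big_nat; apply: eq_bigr => y /andP[_ yk]; rewrite /G yk.
Qed.
End StandardScore.
End Standard.

(** * Lower and upper bounds for the dimension *)

Local Open Scope ring_scope.

Lemma sdim_eq (V : finType) (e : rel V) (R : realType) (sigma : V -> R) m :
  (forall S : {set {ffun V -> V}}, resolving e sigma S -> (m <= #|S|)%N) ->
  (exists S : {set {ffun V -> V}},
     [/\ #|S| = m, S \subset [set B | bracket e B] & resolving e sigma S]) ->
  sdim e sigma = m.
Proof.
move=> lb [S [Sm Sb Sr]]; apply/eqP; rewrite eqn_leq; apply/andP; split.
  (* Running through the enumeration, the minimum is at most [m] once [S] has been met. *)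
  rewrite /sdim; elim: index_enum (mem_index_enum S) => // T r IH.
  rewrite inE big_cons => /predU1P[<-|/IH{}IH]; first by rewrite Sb Sr geq_min Sm leqnn.
  by case: ifP => // _; rewrite geq_min IH orbT.
rewrite /sdim; apply: (big_ind (fun i => m <= i)%N).
(* The default value, the number of all brackets, is at least [m] because it counts the members of
   [S]. *)
- by rewrite -Sm subset_leq_card.
- by move=> i j mi mj; rewrite leq_min mi.
by move=> T /andP[_ /lb].
Qed.

Lemma std_resolving_card (R : realType) k (sigma : std_vertex k.+1 -> R) S :
  resolving (@std_edge k.+1) sigma S -> (2 ^ k <= #|S|)%N.
Proof.
move=> Sr; rewrite leqNgt; apply/negP => Slt.
(* Pigeonhole: among [2 ^ k] consecutive vertices, some vertex is the champion of no bracket in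
   [S]. *)
have free c : (0 < c)%N -> (c + 2 ^ k <= 2 ^ k.+2)%N ->
  exists2 a, (a < 2 ^ k)%N & forall B, B \in S -> B (vtx k.+1 1) != vtx k.+1 (c + a).
  move=> c0 ck; pose I := [set vtx k.+1 (c + val a) | a : 'I_(2 ^ k)].
  have range (a : 'I_(2 ^ k)) : (0 < c + val a < 2 ^ k.+2)%N.
    by rewrite addn_gt0 c0; apply: leq_trans ck; rewrite ltn_add2l; apply: ltn_ord.
  have cardI : #|I| = (2 ^ k)%N.
    rewrite card_imset ?card_ord // => a b /(congr1 (fun x => (val x).+1)).
    by rewrite !vtxK // => ab; apply: val_inj; apply: (@addnI c).
  have : ~~ (I \subset [set B (vtx k.+1 1) | B : {ffun _ -> _} in S]).
    apply: contraTN Slt => /subset_leq_card; rewrite cardI -leqNgt => /leq_trans.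
    by apply; apply: leq_imset_card.
  case/subsetPn => _ /imsetP[a _ ->] aS; exists (val a) => [|B BS]; first exact: ltn_ord.
  by apply: contraNneq aS => <-; apply/imsetP; exists B.
have k0 : (0 < 2 ^ k)%N by rewrite expn_gt0.
have [k1 k2] : (2 ^ k.+1 = 2 * 2 ^ k /\ 2 ^ k.+2 = 4 * 2 ^ k)%N.
  by rewrite !expnS mulnA.
(* The left-half players have heap numbers from [2 * 2 ^ k] on, the right-half players from
   [3 * 2 ^ k] on. *)
have [||a ak aS] := free (2 * 2 ^ k)%N; [lia|lia|].
have [||b bk bS] := free (3 * 2 ^ k)%N; [lia|lia|].
set ta := (2 * 2 ^ k + a)%N in aS; set tb := (3 * 2 ^ k + b)%N in bS.
have ta2 : (ta %/ 2 ^ k = 2)%N by rewrite divnMDl // divn_small.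
have tb3 : (tb %/ 2 ^ k = 3)%N by rewrite divnMDl // divn_small.
pose f := priority [:: ta; tb]; pose g := priority [:: tb; ta].
have fb : bracket_below k.+1 1 f by apply: bracket_below_priority.
have gb : bracket_below k.+1 1 g by apply: bracket_below_priority.
have f1 : f k.+1 1%N = ta by rewrite /f /= divn_exp2S ta2.
have g1 : g k.+1 1%N = tb by rewrite /g /= divn_exp2S tb3.
(* Below the root no vertex has both [ta] and [tb] beneath it, so their relative rank matters only
   in the final. *)
have fg j x : (j <= k)%N -> f j x = g j x.
  move=> jk; rewrite /f /g /=; case: eqP => [ax|//]; case: eqP => [bx|//].
  have : (ta %/ 2 ^ j %/ 2 ^ (k - j) = tb %/ 2 ^ j %/ 2 ^ (k - j))%N by rewrite ax bx.
  by rewrite -!divnMA -expnD subnKC // ta2 tb3.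
have rootE (h : nat -> nat -> nat) : bracket_below k.+1 1 h ->
  decode k.+1 h (vtx k.+1 1) = vtx k.+1 (h k.+1 1%N).
  move=> hb; rewrite -[LHS]val_vtxK; congr vtx.
  by apply: decodeK hb k.+1 1%N _ _; rewrite ?subnn.
have fr := rootE _ fb; have gr := rootE _ gb; rewrite f1 in fr; rewrite g1 in gr.
have sameE x : x != vtx k.+1 1 -> decode k.+1 f x = decode k.+1 g x.
  move=> x1; rewrite !ffunE fg // -ltnS ltn_neqAle height_le andbT.
  apply: contraNneq x1 => hx; have := height_divn (y := (val x).+1) (std_vertex_lt x).
  by rewrite hx subnn divn1 => y1; rewrite -(val_vtxK x) y1.
have neq : decode k.+1 f != decode k.+1 g.
  apply: contraTneq isT => /(congr1 (fun h : {ffun _ -> _} => (val (h (vtx k.+1 1))).+1)).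
  rewrite fr gr !vtxK; rewrite /ta /tb; lia.
have := forallP (forallP Sr (decode k.+1 f)) (decode k.+1 g).
rewrite !bracket_decode // neq => /existsP[B /andP[BS /negP[]]]; apply/eqP.
(* At the root [B] predicts neither [ta] nor [tb], so the final counts in neither score; elsewhere
   the two brackets coincide. *)
apply: eq_bigl => x; congr (_ && _); have [->|x1] := eqVneq x (vtx k.+1 1).
  by rewrite fr gr (negbTE (aS B BS)) (negbTE (bS B BS)).
by rewrite sameE.
Qed.

Lemma std_resolving_rankings (R : realType) k :
  exists S : {set {ffun std_vertex k.+1 -> std_vertex k.+1}},
    [/\ #|S| = (2 ^ k)%N, S \subset [set B | bracket (@std_edge k.+1) B] &
        forall sigma : std_vertex k.+1 -> R,
          scoring_system (@std_edge k.+1) sigma ->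
          resolving (@std_edge k.+1) sigma S].
Proof.
pose f a := priority (ranking 1 k.+1 a).
have fb a : bracket_below k.+1 1 (f a) by apply: bracket_below_priority.
exists [set decode k.+1 (f (val a)) | a : 'I_(2 ^ k)]; split.
(* Different [a] give different champions, [2 ^ k.+1 + a], so the brackets are distinct. *)
- rewrite card_imset ?card_ord // => a b eqab.
  have fE (c : 'I_(2 ^ k)) : f (val c) k.+1 1%N = (2 ^ k.+1 + val c)%N.
    rewrite /f /= mul1n -{1}[(2 ^ k.+1)%N]mul1n divnMDl ?expn_gt0 // divn_small ?eqxx //.
    by apply: leq_trans (ltn_ord c) _; rewrite leq_exp2l.
  apply/val_inj/(@addnI (2 ^ k.+1)%N); rewrite -!fE.
  by rewrite -(decodeK (fb a)) ?subnn // -(decodeK (fb b)) ?subnn //= eqab.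
- by apply/subsetP => _ /imsetP[a _ ->]; rewrite inE bracket_decode.
move=> sigma s0; apply/forallP => B; apply/forallP => B'.
(* Contrapositive: two brackets that no member of the family tells apart have equal scores against
   every ranking, hence coincide by [ranking_resolves]. *)
apply/implyP => /and3P[Bb B'b /negP neq]; apply: contraT => /existsPn nres; case: neq.
apply/eqP/code_inj; apply: (ranking_resolves (weight_gt0 s0)); try exact: bracket_code.
move=> a ak; have := nres (decode k.+1 (f a)).
have aS : decode k.+1 (f a) \in [set decode k.+1 (f (val a)) | a : 'I_(2 ^ k)].
  by apply/imsetP; exists (Ordinal ak).
rewrite aS negbK => /eqP.
have refl (h : nat -> nat -> nat) : agree_below k.+1 1 h h by [].
by rewrite !score_code !(eq_score_below _ (decodeK (fb a)) (refl _)).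
Qed.

Theorem theorem1p5 (R : realType) (k : nat) (hk : (1 <= k)%N) :
  (forall sigma : std_vertex k -> R,
     scoring_system (@std_edge k) sigma ->
     sdim (@std_edge k) sigma = (2 ^ k %/ 2)%N) /\
  (exists S : {set {ffun std_vertex k -> std_vertex k}},
     [/\ #|S| = (2 ^ k %/ 2)%N,
         S \subset [set B | bracket (@std_edge k) B] &
         forall sigma : std_vertex k -> R,
           scoring_system (@std_edge k) sigma -> resolving (@std_edge k) sigma S]).
Proof.
case: k hk => // k _; have -> : (2 ^ k.+1 %/ 2 = 2 ^ k)%N by rewrite expnS mulKn.
have [S [cardS Sb Sr]] := std_resolving_rankings R k.
split; last by exists S.
move=> sigma s0; apply: sdim_eq => [T|]; first exact: std_resolving_card.
by exists S; split=> //; apply: Sr.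
Qed.
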